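(* Let $p$ be a prime with $p\equiv 1\pmod{20}$ or $p\equiv 9\pmod{20}$. Then for every positive integer $k$, $$\overline{pp}(5p^k)\equiv 3(k+1)\pmod 5.$$
   Context: For $|q|<1$, $(a;q)_\infty=\prod_{k=1}^\infty(1-aq^{k-1})$. An overpartition of $n$ is a partition of $n$ in which the first occurrence of each number may be overlined; there is exactly one overpartition of $0$ (the empty one). An overpartition pair of $n$ is an ordered pair $(\lambda,\mu)$ of overpartitions such that the sum of all parts of $\lambda$ and $\mu$ is $n$ (either may be the overpartition of $0$). $\overline{pp}(n)$ denotes the number of overpartition pairs of $n$; its generating function is $\sum_{n\ge 0}\overline{pp}(n)q^n=(-q;q)_\infty^2/(q;q)_\infty^2$. *)

(* Defs.v *)
From mathcomp Require Import all_boot.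

Set Implicit Arguments.
Unset Strict Implicit.
Unset Printing Implicit Defensive.

(* A weakly decreasing list of positive parts, each tagged [true] when it is
   overlined; a part may be overlined only if no equal part precedes it. *)
Definition is_overpartition (s : seq (nat * bool)) : bool :=
  [&& sorted geq (unzip1 s),
      all (leq 1) (unzip1 s) &
      [forall i : 'I_(size s),
         nth false (unzip2 s) i ==> (nth 0 (unzip1 s) i \notin take i (unzip1 s))]].

Definition weight (s : seq (nat * bool)) : nat := sumn (unzip1 s).

Definition is_overpartition_pair (n : nat)
    (u : seq (nat * bool) * seq (nat * bool)) : bool :=
  [&& is_overpartition u.1, is_overpartition u.2 & weight u.1 + weight u.2 == n].

(* Finite search space: overpartitions of weight at most n have at most n parts,
   all of them at most n.  That no overpartition pair is lost is [num_opairsP]. *)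
Definition bounded (n : nat) : finType := n.-bseq ('I_n.+1 * bool)%type.

Definition unbound (n : nat) (s : bounded n) : seq (nat * bool) :=
  [seq (val x.1, x.2) | x <- (s : n.-bseq ('I_n.+1 * bool))].

Definition num_opairs (n : nat) : nat :=
  #|[set u : bounded n * bounded n | is_overpartition_pair n (unbound u.1, unbound u.2)]|.

Lemma unbound_inj n : injective (@unbound n).
Proof.
move=> s t /inj_map eq_st; apply/val_inj/eq_st.
by move=> [i a] [j b] [/val_inj -> ->].
Qed.

Lemma unbound_onto n s :
  is_overpartition s -> weight s <= n -> exists t : bounded n, unbound t = s.
Proof.
case/and3P=> _ pos_s _; rewrite /weight => le_s.
have le_size (r : seq (nat * bool)) :
  all (leq 1) (unzip1 r) -> size r <= sumn (unzip1 r).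
  elim: r => //= x r IHr /andP[x_gt0 /IHr le_r].
  by rewrite -addn1 addnC leq_add.
have size_s: size [seq (inord x.1 : 'I_n.+1, x.2) | x <- s] <= n.
  by rewrite size_map (leq_trans (le_size _ pos_s)).
exists (Bseq size_s); rewrite /unbound /= -map_comp.
elim: s le_s {pos_s size_s} => //= -[a b] s IHs /= le_s.
rewrite inordK ?IHs //; first exact: leq_trans (leq_addl _ _) le_s.
by rewrite ltnS (leq_trans (leq_addr _ _) le_s).
Qed.

Lemma num_opairsP n (r : seq (seq (nat * bool) * seq (nat * bool))) :
  uniq r -> (forall u, (u \in r) = is_overpartition_pair n u) ->
  size r = num_opairs n.
Proof.
move=> uniq_r in_r; rewrite /num_opairs cardE.
set A := enum _; pose f (u : bounded n * bounded n) := (unbound u.1, unbound u.2).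
rewrite -(size_map f A); apply/perm_size/uniq_perm => //.
  rewrite map_inj_uniq ?enum_uniq // => -[a b] [c d] [].
  by move=> /unbound_inj -> /unbound_inj ->.
move=> u; rewrite in_r; apply/idP/mapP => [pair_u|[v]]; last first.
  by rewrite mem_enum inE => pair_v ->.
have /and3P[op1 op2 /eqP wE] := pair_u.
have [a Ea] : exists a : bounded n, unbound a = u.1.
  by apply: unbound_onto; rewrite // -wE leq_addr.
have [b Eb] : exists b : bounded n, unbound b = u.2.
  by apply: unbound_onto; rewrite // -wE leq_addl.
exists (a, b); last by rewrite /f /= Ea Eb -surjective_pairing.
by rewrite mem_enum inE /= Ea Eb -surjective_pairing.
Qed.

(* Main.v *)
Require Import Defs.
From mathcomp Require Import all_boot.
From mathcomp Require Import all_order all_algebra cyclic finfield ring zify.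

(** The generating function of overpartitions is [P = (-q; q) / (q; q)], and by
    Gauss's identity [P t = 1], where [t = sum_(x in Z) (-1)^x q^(x^2)]; thus
    overpartition pairs are generated by [P^2 = t^-2].

    Modulo [5] one has [P^5 = P(q^5)], hence [P^2 = P^5 t^3 = P(q^5) t^3].
    Extracting the exponents divisible by [5] gives [P U(t^3)], where [U] keeps
    the coefficients of exponent [5 n].  A sum of three squares divisible by [5]
    has exactly one term divisible by [5] or has all three so, which expresses
    [U(t^3)] by [U(t^2)] and [t(q^5)] ([section_theta_cube]); and [U(t^2)] is
    known because [5 = 1^2 + 2^2] splits in the Gaussian integers
    ([section_theta_sqr]).  The result is [U(t^3) = t^2 t(q^5)] modulo [5].
    Therefore the pairs of weight [5 n] are generated by
    [P t^2 t(q^5) = t t(q^5)]: their number is [(-1)^n r(n)] modulo [5], with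
    [r(n)] the number of integer solutions of [x^2 + 5 y^2 = n]
    ([num_opairs_pchar5]).

    It remains to count the solutions for [n = p^k].  A prime [p] that is [1] or
    [9] modulo [20] is itself of the form [a^2 + 5 b^2]: [-5] is a square modulo
    [p] ([dvdn_sqr_add5]), and Thue's lemma applies ([prime_form5]).  In
    [Z[sqrt(-5)]] an element of norm divisible by [p] is a multiple of
    [a + b sqrt(-5)] or of its conjugate, whence
    [r(p^(k+2)) + r(p^k) = 2 r(p^(k+1))] and [r(p^k) = 2 (k + 1)]
    ([size_reps_pow]).  As [p] is odd, the number of pairs is [- 2 (k + 1)],
    that is, [3 (k + 1)] modulo [5]. *)

Set Implicit Arguments.
Unset Strict Implicit.
Unset Printing Implicit Defensive.
Import Order.TTheory GRing.Theory Num.Theory.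

(** * Enumeration of overpartitions *)

(** Ordering the letters of an overpartition by [code] places the plain part [a]
    just below the overlined part [a]; an overpartition is then a weakly
    decreasing word in which plain letters may repeat and overlined ones may
    not. *)
Definition code (x : nat * bool) : nat := x.1.*2 + x.2.

(** The bound [x.1.*2.+1] is the same whether or not [x] is overlined: after
    either kind of part [a] may come a plain [a] or any smaller letter, that is,
    exactly the letters of code at most [2 a]. *)
Lemma is_overpartition_cons x s :
  is_overpartition (x :: s) =
  [&& 0 < x.1, is_overpartition s & all (fun y => code y < x.1.*2.+1) s].
Proof.
rewrite /is_overpartition /= (path_sortedE (rev_trans leq_trans)).
have -> : [forall i : 'I_(size s).+1,
    nth false (x.2 :: unzip2 s) i ==>
      (nth 0 (x.1 :: unzip1 s) i \notin take i (x.1 :: unzip1 s))] =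
  [forall i : 'I_(size s),
    nth false (unzip2 s) i ==> (nth 0 (unzip1 s) i \notin take i (unzip1 s))]
  && all (fun y => y.2 ==> (y.1 != x.1)) s.
  apply/forallP/andP => [H | [/forallP H /allP Hx] i].
    split.
      apply/forallP => i; have /= := H (lift ord0 i).
      by rewrite inE negb_or => /implyP Hi; apply/implyP => /Hi /andP[].
    apply/(all_nthP (0, false)) => i lt_i.
    have /= := H (lift ord0 (Ordinal lt_i)).
    rewrite inE negb_or (nth_map (0, false)) // (nth_map (0, false)) //=.
    by move=> /implyP Hi; apply/implyP => /Hi /andP[].
  case: (unliftP ord0 i) => [j|] -> /=; last by rewrite implybT.
  apply/implyP => Hj; rewrite inE negb_or (implyP (H j) Hj) andbT.
  have lt_j := ltn_ord j; move: Hj.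
  rewrite (nth_map (0, false)) // (nth_map (0, false)) //.
  by apply/implyP/Hx/mem_nth.
have -> : all (fun y => code y < x.1.*2.+1) s =
  all (geq x.1) (unzip1 s) && all (fun y => y.2 ==> (y.1 != x.1)) s.
  rewrite all_map -all_predI; apply: eq_all => -[y b] /=.
  rewrite /code /=; case: b => /=; lia.
by case: (0 < x.1); case: (all (geq _) _); case: (all (fun y => _ ==> _) _);
  rewrite ?andbT ?andbF.
Qed.

Definition overpartition_below (c n : nat) (s : seq (nat * bool)) : bool :=
  [&& is_overpartition s, all (fun y => code y < c) s & weight s == n].

Definition overpartitions_below (c n : nat) : seq (seq (nat * bool)) :=
  [seq s <- map (@unbound n) (enum (bounded n)) | overpartition_below c n s].

Lemma uniq_overpartitions_below c n : uniq (overpartitions_below c n).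
Proof. by rewrite filter_uniq // map_inj_uniq ?enum_uniq //; apply: unbound_inj. Qed.

Lemma mem_overpartitions_below c n s :
  (s \in overpartitions_below c n) = overpartition_below c n s.
Proof.
rewrite mem_filter; case E: (overpartition_below c n s) => //=.
have /and3P[op_s _ /eqP ws] := E.
have [t <-] : exists t : bounded n, unbound t = s by apply: unbound_onto; rewrite ?ws.
by rewrite map_f // mem_enum.
Qed.

(** Letters are admitted one code at a time: a word that uses the letter [x] of
    largest admitted code must start with it. *)
Lemma overpartition_below_rec x n s : 0 < x.1 ->
  overpartition_below (code x).+1 n s =
  overpartition_below (code x) n s ||
  (if s is y :: s' then
     [&& y == x, x.1 <= n & overpartition_below x.1.*2.+1 (n - x.1) s'] else false).
Proof.
case: x s => a b [|[a' b'] s] a_gt0; first by rewrite /overpartition_below /= orbF.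
rewrite /overpartition_below is_overpartition_cons /=.
rewrite /weight /= -/(weight s).
case: (ltngtP (code (a', b')) (code (a, b))) => [lt_c|gt_c|eq_c].
- have ne : ((a', b') == (a, b)) = false.
    by apply/eqP => E; move: lt_c; rewrite E ltnn.
  rewrite ne ltnS (ltnW lt_c) /= orbF.
  have [] := boolP (all (fun y => code y < a'.*2.+1) s); last by rewrite !andbF.
  move=> /allP H; congr (_ && _); congr (_ && _).
  rewrite !(introT allP) // => y /H; move: lt_c; rewrite /code /=; lia.
- have ne : ((a', b') == (a, b)) = false.
    by apply/eqP => E; move: gt_c; rewrite E ltnn.
  have -> : (code (a', b') < (code (a, b)).+1) = false.
    by apply/negbTE; rewrite -leqNgt.
  by rewrite ne !andbF.
have [-> ->] : a' = a /\ b' = b.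
  by move: eq_c; rewrite /code /=; case: (b) (b') => -[] /=; split => //; lia.
rewrite eqxx ltnS leqnn !andbF /= a_gt0 /=.
have [] := boolP (all (fun y => code y < a.*2.+1) s) => [/allP H|_]; last by rewrite !andbF.
rewrite andbT (introT allP) /=; last by move=> y /H; rewrite /code /=; lia.
case: leqP => le_an; last by rewrite /= andbC; case: eqP => //; lia.
by congr (_ && _); lia.
Qed.

(** For [x] plain, [x.1.*2.+1] is [(code x).+1] and the rule is multiplication of
    the generating function by [1 / (1 - q^a)]; for [x] overlined it is
    [code x] and the rule is multiplication by [1 + q^a]. *)
Lemma size_overpartitions_below_rec x n : 0 < x.1 ->
  size (overpartitions_below (code x).+1 n) =
  size (overpartitions_below (code x) n) +
  (if x.1 <= n then size (overpartitions_below x.1.*2.+1 (n - x.1)) else 0).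
Proof.
move=> x_gt0.
pose r := if x.1 <= n then overpartitions_below x.1.*2.+1 (n - x.1) else [::].
have -> : (if x.1 <= n then size (overpartitions_below x.1.*2.+1 (n - x.1)) else 0)
  = size (map (cons x) r) by rewrite /r size_map; case: ifP.
rewrite -size_cat; apply/perm_size/uniq_perm.
- exact: uniq_overpartitions_below.
- rewrite cat_uniq uniq_overpartitions_below map_inj_uniq => [|s t []//].
  rewrite /r; case: ifP => _ //=; rewrite uniq_overpartitions_below andbT.
  apply/hasPn => _ /mapP[s _ ->] /=; rewrite mem_overpartitions_below.
  by rewrite /overpartition_below /= ltnn andbF.
move=> s; rewrite mem_cat !mem_overpartitions_below overpartition_below_rec //.
congr (_ || _); apply/idP/mapP => [|[s' s'_r ->]].
  case: s => // y s /and3P[/eqP-> le_n ov_s]; exists s => //.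
  by rewrite /r le_n mem_overpartitions_below.
move: s'_r; rewrite /r; case: ifP => // _; rewrite mem_overpartitions_below.
by rewrite eqxx.
Qed.

Lemma size_overpartitions_below2 n : size (overpartitions_below 2 n) = (n == 0).
Proof.
have E s : overpartition_below 2 n s = (s == [::]) && (n == 0).
  rewrite /overpartition_below; case: s => [|[a b] s].
    have -> : is_overpartition [::] by apply/and3P; split=> //; apply/forallP=> -[].
    by rewrite /= eq_sym.
  rewrite is_overpartition_cons /code /=; case: a => [|a] //=.
  by rewrite andbF.
rewrite -(size_nseq (n == 0) ([::] : seq (nat * bool))).
apply/perm_size/uniq_perm; rewrite ?uniq_overpartitions_below //; first by case: eqP.
move=> s; rewrite mem_overpartitions_below E mem_nseq andbC.
by case: (n == 0).
Qed.

(** In weight [n] every code is at most [2 n + 1], so the bound on codes is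
    vacuous. *)
Definition num_overpartitions n := size (overpartitions_below n.*2.+2 n).

Lemma code_lt_weight s : all (fun y => code y < (weight s).*2.+2) s.
Proof.
rewrite /weight; apply/allP => y y_s.
have : y.1 <= sumn (unzip1 s).
  elim: s y_s => //= x s IH; rewrite inE => /orP[/eqP->|/IH]; first exact: leq_addr.
  by move/leq_trans; apply; apply: leq_addl.
by rewrite /code; case: (y.2) => /=; lia.
Qed.

Lemma size_overpartitions_all c n : n.*2.+2 <= c ->
  size (overpartitions_below c n) = num_overpartitions n.
Proof.
move=> le_c; apply/perm_size/uniq_perm; rewrite ?uniq_overpartitions_below //.
move=> s; rewrite !mem_overpartitions_below /overpartition_below.
case op_s: (is_overpartition s) => //=.
case: eqP => [ws|]; last by rewrite !andbF.
have /allP H := code_lt_weight s; rewrite ws in H.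
by rewrite !(introT allP) // => y /H // /leq_trans; apply.
Qed.

Lemma num_opairs_conv n :
  num_opairs n = \sum_(i < n.+1) num_overpartitions i * num_overpartitions (n - i).
Proof.
pose S := [seq s <- map (@unbound n) (enum (bounded n)) | is_overpartition s && (weight s <= n)].
have uS : uniq S by rewrite filter_uniq // map_inj_uniq ?enum_uniq //; apply: unbound_inj.
have mS s : (s \in S) = is_overpartition s && (weight s <= n).
  rewrite mem_filter; case Es: (is_overpartition s && _) => //=.
  have /andP[op ws] := Es.
  have [t <-] : exists t : bounded n, unbound t = s by apply: unbound_onto.
  by rewrite map_f // mem_enum.
pose E i := overpartitions_below i.*2.+2 i.
have mE i s : (s \in E i) = is_overpartition s && (weight s == i).
  rewrite mem_overpartitions_below /overpartition_below; case op_s: is_overpartition => //=.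
  by case: eqP => [<-|]; rewrite ?code_lt_weight ?andbF.
rewrite -(@num_opairsP n [seq (s, t) | s <- S, t <- E (n - weight s)]); first last.
- move=> [s t]; rewrite /is_overpartition_pair /=.
  apply/allpairsPdep/and3P => [[s' [t' [+ + [-> ->]]]] | [op_s op_t /eqP w]].
    by rewrite mS mE => /andP[-> ws] /andP[-> /eqP->]; split=> //; rewrite subnKC.
  by exists s, t; rewrite mS mE op_s op_t -w leq_addr addKn eqxx.
- apply: allpairs_uniq_dep => //.
    by move=> s _; apply: uniq_overpartitions_below.
  by move=> [s t] [s' t'] _ _ /= [-> ->].
rewrite size_allpairs_dep sumnE big_map.
rewrite big_seq (partition_big (fun s => inord (weight s) : 'I_n.+1) predT) //=.
apply: eq_bigr => i _.
transitivity (\sum_(s <- S | (s \in S) && (inord (weight s) == i)) num_overpartitions (n - i)).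
  apply: eq_bigr => s /andP[s_S /eqP <-].
  by rewrite inordK //; move: s_S; rewrite mS => /andP[].
transitivity (\sum_(s <- E i) num_overpartitions (n - i)); last first.
  by rewrite big_const_seq count_predT iter_addn_0 mulnC.
rewrite [RHS]big_seq -(big_filter S) -[RHS](big_filter (E i)).
have P : perm_eq [seq s <- S | (s \in S) && (inord (weight s) == i)]
  [seq s <- E i | s \in E i].
  apply: uniq_perm => [||s]; [exact: filter_uniq|exact/filter_uniq/uniq_overpartitions_below|].
  rewrite [LHS]mem_filter [RHS]mem_filter !andbb mE mS; case: (is_overpartition s) => //=.
  have := ltn_ord i; rewrite ltnS => le_in.
  case: leqP => [ws|ws] /=; last by apply/esym/negbTE; lia.
  by rewrite andbT -(inj_eq val_inj) /= inordK.
by rewrite (perm_big _ P).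
Qed.

Local Open Scope ring_scope.

(** * A finite form of Gauss's identity *)

(** The quotient [(q; q)_n / (q; q)_s], kept as a product so that no division
    takes place. *)
Definition qtail (R : comNzRingType) (q : R) (s n : nat) : R :=
  \prod_(s <= i < n) (1 - q ^+ i.+1).

(** The rising product [(-1; q)_s]. *)
Definition qneg1 (R : comNzRingType) (q : R) (s : nat) : R := \prod_(i < s) (1 + q ^+ i).

(** With [v = q^(n + 1)] the bracket is [- (1 - q^s) - v (1 + q^s)].  Its first
    half turns [qtail q s n] into [qtail q s.-1 n]; its second half turns
    [qneg1 q s] into [qneg1 q s.+1] and [v^s] into [v^(s + 1)].
    So the second half of each summand cancels the first half of the next. *)
Lemma shanks_telescope (R : comNzRingType) (q : R) n m : (m <= n)%N ->
  \sum_(s < m.+1) (-1) ^+ s * qneg1 q s * qtail q s n * q ^+ (s * n.+1)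
     * ((1 - q ^+ n.+1) * q ^+ s - (1 + q ^+ n.+1)) =
  (-1) ^+ m.+1 * qneg1 q m.+1 * qtail q m n * q ^+ (m.+1 * n.+1).
Proof.
elim: m => [|m IH] le_mn.
  rewrite big_ord1 /qneg1 big_ord0 big_ord1 /= mul0n mul1n !expr0 expr1.
  by move: (q ^+ n.+1) (qtail q 0 n) => u w; ring.
rewrite big_ord_recr /= IH ?(ltnW le_mn) // {1}/qtail big_ltn // -/(qtail q m.+1 n).
rewrite [qneg1 q m.+2]/qneg1 big_ord_recr /= -/(qneg1 q m.+1).
rewrite [(m.+2 * _)%N]mulSnr !exprD.
rewrite [(-1) ^+ m.+2]exprS.
move: (q ^+ m.+1) (q ^+ n.+1) (q ^+ (_ * _)) => u v w.
ring.
Qed.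

(** A finite form, in the style of Shanks, of Gauss's identity
    [(q; q) / (-q; q) = sum_(j in Z) (-1)^j q^(j^2)].  The term [s = 0] on the
    right is [(q; q)_n], and all the others are divisible by [q^(n + 1)]. *)
Lemma shanks (R : comNzRingType) (q : R) n :
  \prod_(i < n) (1 + q ^+ i.+1) * (1 + \sum_(j < n) 2 * (-1) ^+ j.+1 * q ^+ (j.+1 ^ 2))
  = \sum_(s < n.+1) (-1) ^+ s * qneg1 q s * qtail q s n * q ^+ (s * n.+1).
Proof.
elim: n => [|n IH].
  by rewrite !big_ord0 big_ord1 /qneg1 /qtail big_ord0 big_geq // !expr0 /=; ring.
have qtailS s : (s <= n)%N -> qtail q s n.+1 = qtail q s n * (1 - q ^+ n.+1).
  by move=> le_s; rewrite /qtail big_nat_recr.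
rewrite big_ord_recr /= [in LHS]big_ord_recr /= addrA mulrDr.
rewrite mulrAC IH [RHS]big_ord_recr /=.
have -> : \sum_(i < n.+1) (-1) ^+ i * qneg1 q i * qtail q i n.+1 * q ^+ (i * n.+2) =
   (\sum_(s < n.+1) (-1) ^+ s * qneg1 q s * qtail q s n * q ^+ (s * n.+1)) * (1 + q ^+ n.+1) +
   (-1) ^+ n.+1 * qneg1 q n.+1 * qtail q n n * q ^+ (n.+1 * n.+1).
  rewrite -(shanks_telescope q (leqnn n)) mulr_suml -big_split /=.
  apply: eq_bigr => i _; have le_i : (i <= n)%N := ltn_ord i.
  rewrite (qtailS i le_i) (_ : (i * n.+2 = i + i * n.+1)%N) ?mulnS // exprD.
  move: (q ^+ n.+1) (q ^+ i) (q ^+ (i * n.+1)) ((-1) ^+ i) (qneg1 q i) (qtail q i n)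
    => u v w z a b.
  ring.
rewrite -addrA; congr (_ + _).
have qtailnn m : qtail q m m = 1 by rewrite /qtail big_geq.
rewrite !qtailnn mulnn.
have -> : qneg1 q n.+1 = 2 * \prod_(i < n) (1 + q ^+ i.+1).
  by rewrite /qneg1 big_ord_recl.
rewrite mulnS exprD mulnn.
move: (\prod_(i < n) _) (q ^+ n.+1) (q ^+ (n.+1 ^ 2)) ((-1) ^+ n.+1) => P u v w.
ring.
Qed.

(** * Representations by the form x^2 + d y^2 *)

(** The integers of absolute value at most [M], listed so that passing from [M]
    to [M + 1] adds the two new values in front. *)
Fixpoint box (M : nat) : seq int :=
  if M is m.+1 then [:: M%:Z, - M%:Z & box m] else [:: 0].

Lemma mem_box M (x : int) : (x \in box M) = (`|x| <= M)%N.
Proof. by elim: M => [|M IH]; rewrite /= ?inE ?IH; lia. Qed.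

Lemma uniq_box M : uniq (box M).
Proof. by elim: M => [|M IH] //=; rewrite inE !mem_box IH; lia. Qed.

Definition norm_form (d : nat) (z : int * int) : int := z.1 ^+ 2 + d%:Z * z.2 ^+ 2.

(** For [d > 0] a solution of [x^2 + d y^2 = n] has both coordinates at most [n]
    in absolute value, so the box loses none. *)
Definition reps (d n : nat) : seq (int * int) :=
  [seq z <- [seq (x, y) | x <- box n, y <- box n] | norm_form d z == n%:Z].

Lemma mem_box_pairs M z :
  (z \in [seq (x, y) | x <- box M, y <- box M]) = (`|z.1| <= M)%N && (`|z.2| <= M)%N.
Proof.
case: z => x y /=; rewrite -!mem_box.
apply/allpairsP/andP => [[[x' y'] /= [? ? [-> ->]]]|[hx hy]] //.
by exists (x, y).
Qed.

Lemma uniq_box_pairs M : uniq [seq (x, y) | x <- box M, y <- box M].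
Proof. by apply: allpairs_uniq; rewrite ?uniq_box // => -[? ?] [? ?] _ _ [-> ->]. Qed.

Lemma norm_form_bound d n z : (0 < d)%N -> norm_form d z = n%:Z ->
  (`|z.1| <= n)%N && (`|z.2| <= n)%N.
Proof.
case: z => x y; rewrite /norm_form /= => d_gt0 E; apply/andP; split; nia.
Qed.

Lemma mem_reps d n z : (0 < d)%N -> (z \in reps d n) = (norm_form d z == n%:Z).
Proof.
move=> d_gt0; rewrite mem_filter mem_box_pairs; case: eqP => //= /norm_form_bound; exact.
Qed.

Lemma uniq_reps d n : uniq (reps d n).
Proof. by rewrite filter_uniq // uniq_box_pairs. Qed.

Lemma Euclid_dvdzM (p : nat) (x y : int) : prime p ->
  (p %| x * y)%Z = (p %| x)%Z || (p %| y)%Z.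
Proof. by move=> p_pr; rewrite !dvdzE abszM Euclid_dvdM. Qed.

Lemma dvdzD (c x y : int) : (c %| x -> c %| y -> c %| x + y)%Z.
Proof. by move=> cx cy; rewrite -[(c %| _)%Z]/(x + y \in dvdz c) rpredD. Qed.

Lemma dvdzB (c x y : int) : (c %| x -> c %| y -> c %| x - y)%Z.
Proof. by move=> cx cy; rewrite -[(c %| _)%Z]/(x - y \in dvdz c) rpredB. Qed.

(** Multiplication by [a + b sqrt(-d)] on [Z[sqrt(-d)]]. *)
Definition twist (d : nat) (a b : int) (z : int * int) : int * int :=
  (a * z.1 - d%:Z * b * z.2, b * z.1 + a * z.2).

Lemma norm_form_twist d a b z : norm_form d (twist d a b z) = norm_form d (a, b) * norm_form d z.
Proof. by rewrite /norm_form /twist /=; ring. Qed.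

(** Let [pi = a + b sqrt(-d)], of norm [p].  The condition says that the second
    coordinate of [z] times the conjugate of [pi] is divisible by [p]; the first
    one is then divisible too, because the norm of the product is [p^2 n].  So
    the listed solutions are exactly the multiples of [pi], and division by
    [pi] maps them to the solutions for [n]. *)
Lemma size_reps_twist d p n (a b : int) : (0 < d)%N -> prime p -> norm_form d (a, b) = p%:Z ->
  size [seq z <- reps d (p * n) | (p %| a * z.2 - b * z.1)%Z] = size (reps d n).
Proof.
move=> d_gt0 p_pr Ep; rewrite -[RHS](size_map (twist d a b)).
have p_n0 : p%:Z != 0 by have := prime_gt0 p_pr; lia.
have tw z : twist d a (- b) (twist d a b z) = (p%:Z * z.1, p%:Z * z.2).
  by rewrite -Ep /twist /norm_form /=; congr pair; ring.
apply/perm_size/uniq_perm; first by rewrite filter_uniq ?uniq_reps.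
  rewrite map_inj_uniq ?uniq_reps // => -[x y] [x' y'] E.
  have [Ex Ey] : (p%:Z * x, p%:Z * y) = (p%:Z * x', p%:Z * y').
    by rewrite -(tw (x, y)) -(tw (x', y')) E.
  by congr pair; apply: (mulfI p_n0).
move=> z; rewrite mem_filter mem_reps //; apply/andP/mapP => [[dv /eqP E]|[z' + ->]]; last first.
  rewrite mem_reps // => /eqP E; rewrite norm_form_twist E Ep PoszM eqxx; split=> //.
  apply/dvdzP; exists z'.2; rewrite -Ep /twist /norm_form /=; ring.
case: z dv E => x y /= dv E.
pose u := a * x + d%:Z * b * y; pose v := a * y - b * x.
have Euv : norm_form d (u, v) = p%:Z * (p%:Z * n%:Z).
  by rewrite -PoszM -E -Ep /norm_form /u /v /=; ring.
have dvu : (p %| u)%Z.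
  have : (p %| u * u)%Z.
    rewrite -expr2; have -> : u ^+ 2 = p%:Z * (p%:Z * n%:Z) - d%:Z * v * v.
      by rewrite -Euv /norm_form /=; ring.
    apply: dvdzB; [exact: dvdz_mulr|exact: dvdz_mull].
  by rewrite Euclid_dvdzM // orbb.
have [u' Eu] := dvdzP dvu; have [v' Ev] := dvdzP dv.
have E' : norm_form d (u', v') = n%:Z.
  apply: (mulfI p_n0); apply: (mulfI p_n0); rewrite -Euv Eu /v Ev /norm_form /=; ring.
exists (u', v'); first by rewrite mem_reps ?E'.
have [Ex Ey] : x * p%:Z = a * u - d%:Z * b * v /\ y * p%:Z = b * u + a * v.
  by rewrite -Ep /norm_form /u /v /=; split; ring.
congr pair; apply: (mulIf p_n0) => /=.
  by rewrite Ex Eu /v Ev; ring.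
by rewrite Ey Eu /v Ev; ring.
Qed.

(** An element whose norm is divisible by [p] is a multiple of [pi] or of its
    conjugate, and a multiple of both is a multiple of [p]: inclusion-exclusion
    over these two sets, each counted by [size_reps_twist]. *)
Lemma size_reps_mul_prime d p n (a b : int) :
  prime p -> (2 < p)%N -> (0 < d < p)%N -> norm_form d (a, b) = p%:Z ->
  (size (reps d (p * n)) + (if (p %| n)%N then size (reps d (n %/ p)) else 0)
   = 2 * size (reps d n))%N.
Proof.
move=> p_pr p_gt2 /andP[d_gt0 d_lt] Ep.
have p_gt0 := prime_gt0 p_pr.
have p_n0 : p%:Z != 0 by lia.
have nsq m : (p * m = 1)%N -> False.
  by move/eqP; rewrite muln_eq1 => /andP[/eqP p1 _]; rewrite p1 in p_gt2.
have ndvd_d : (p %| d%:Z)%Z = false by rewrite dvdzE /= gtnNdvd.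
have ndvd_ab : ~ ((p %| a)%Z /\ (p %| b)%Z).
  move=> [/dvdzP[a' Ea] /dvdzP[b' Eb]].
  have : p%:Z * (p%:Z * norm_form d (a', b')) = p%:Z * 1.
    by rewrite mulr1 -[RHS]Ep Ea Eb /norm_form /=; ring.
  by move/(mulfI p_n0) => E; move: (nsq `|norm_form d (a', b')|%N); apply; lia.
have dvd_ba : (p %| b)%Z -> (p %| a)%Z.
  move=> pb; have : (p %| a * a)%Z.
    have -> : a * a = p%:Z - (d%:Z * b) * b by rewrite -Ep /norm_form /=; ring.
    by rewrite dvdzB ?dvdz_mull.
  by rewrite Euclid_dvdzM // orbb.
have dvd_ab : (p %| a)%Z -> (p %| b)%Z.
  move=> pa; have : (p %| d%:Z * (b * b))%Z.
    have -> : d%:Z * (b * b) = p%:Z - a * a by rewrite -Ep /norm_form /=; ring.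
    by rewrite dvdzB ?dvdz_mull.
  by rewrite !Euclid_dvdzM // orbb ndvd_d.
have ndvd_a : (p %| a)%Z = false by apply/negP => pa; apply: ndvd_ab; split; auto.
have ndvd_b : (p %| b)%Z = false by apply/negP => pb; apply: ndvd_ab; split; auto.
have ndvd_2 : (p %| 2%:Z)%Z = false by rewrite dvdzE /= gtnNdvd.
pose P1 (z : int * int) := (p %| a * z.2 - b * z.1)%Z.
pose P2 (z : int * int) := (p %| a * z.2 - (- b) * z.1)%Z.
have E1 : count P1 (reps d (p * n)) = size (reps d n).
  by rewrite -size_filter; apply: size_reps_twist.
have E2 : count P2 (reps d (p * n)) = size (reps d n).
  by rewrite -size_filter; apply: size_reps_twist => //; rewrite -Ep /norm_form /=; ring.
rewrite mul2n -addnn -{1}E1 -E2 -count_predUI; congr addn.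
  apply/esym/eqP; rewrite -all_count; apply/allP => -[x y].
  rewrite mem_reps // => /eqP E; rewrite /= -Euclid_dvdzM //=.
  have -> : (a * y - b * x) * (a * y - (- b) * x) = p%:Z * (y ^+ 2 - b ^+ 2 * n%:Z).
    transitivity (p%:Z * y ^+ 2 - b ^+ 2 * (p * n)%N%:Z); last by rewrite PoszM; ring.
    by rewrite -E -Ep /norm_form /=; ring.
  exact: dvdz_mulr.
rewrite -size_filter.
have dvd_xy x y : P1 (x, y) && P2 (x, y) = (p %| x)%Z && (p %| y)%Z.
  apply/andP/andP=> [[]|[px py]]; rewrite /P1 /P2 /=; last first.
    by rewrite !dvdzB ?dvdz_mull.
  move=> h1 h2; split.
    have : (p %| 2%:Z * (b * x))%Z.
      have -> : 2%:Z * (b * x) = (a * y - (- b) * x) - (a * y - b * x) by ring.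
      by rewrite dvdzB.
    by rewrite !Euclid_dvdzM // ndvd_2 ndvd_b.
  have : (p %| 2%:Z * (a * y))%Z.
    have -> : 2%:Z * (a * y) = (a * y - (- b) * x) + (a * y - b * x) by ring.
    by rewrite dvdzD.
  by rewrite !Euclid_dvdzM // ndvd_2 ndvd_a.
pose h (z : int * int) := (p%:Z * z.1, p%:Z * z.2).
pose r := if (p %| n)%N then reps d (n %/ p) else [::].
transitivity (size (map h r)); first by rewrite size_map /r; case: ifP.
apply/perm_size/uniq_perm; last first.
- move=> [x y]; rewrite mem_filter [predI _ _ _]dvd_xy mem_reps //.
  apply/mapP/andP => [[[x' y']]|[/andP[/dvdzP[x' ->] /dvdzP[y' ->]] /eqP E]].
    rewrite /r; case: ifP => // /dvdnP[m Em]; rewrite mem_reps // Em mulnK // => /eqP E [-> ->].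
    rewrite !dvdz_mulr //; split=> //; apply/eqP.
    by rewrite !PoszM -E /norm_form /=; ring.
  have En : n%:Z = p%:Z * norm_form d (x', y').
    by apply: (mulfI p_n0); rewrite -PoszM -E /norm_form /=; ring.
  have pn : (p %| n)%N by have : (p %| n%:Z)%Z by rewrite En dvdz_mulr.
  exists (x', y'); last by rewrite /h /=; congr pair; ring.
  rewrite /r pn mem_reps //; apply/eqP/(mulfI p_n0).
  by rewrite -En -PoszM mulnC divnK.
- by rewrite filter_uniq ?uniq_reps.
rewrite map_inj_uniq => [|[x y] [x' y'] [/(mulfI p_n0) -> /(mulfI p_n0) ->] //].
by rewrite /r; case: ifP => // _; rewrite uniq_reps.
Qed.

(** The recurrence [r(p^(k+2)) + r(p^k) = 2 r(p^(k+1))] makes [r(p^k)] an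
    arithmetic progression in [k]; it starts with [r(1) = 2] and [r(p) = 4]. *)
Lemma size_reps_pow d p k (a b : int) : (1 < d)%N ->
  prime p -> (2 < p)%N -> (d < p)%N -> norm_form d (a, b) = p%:Z ->
  size (reps d (p ^ k)) = (2 * k.+1)%N.
Proof.
move=> d_gt1 p_pr p_gt2 d_lt Ep.
have rec n := size_reps_mul_prime n p_pr p_gt2 (introT andP (conj (ltnW d_gt1) d_lt)) Ep.
have r1 : size (reps d 1) = 2%N.
  have P : perm_eq (reps d 1) [:: (1, 0); (-1, 0)].
    apply: uniq_perm; rewrite ?uniq_reps // => -[x y].
    rewrite mem_reps ?(ltnW d_gt1) // !inE !xpair_eqE /norm_form /=.
    have [->|y_n0] := eqVneq y 0; first by rewrite expr0n mulr0 addr0 !andbT sqrf_eq1.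
    rewrite !andbF; apply/negbTE/eqP => E.
    have : 1 <= y ^+ 2 by nia.
    nia.
  exact: (perm_size P).
have p_gt0 := prime_gt0 p_pr.
have [//] : size (reps d (p ^ k)) = (2 * k.+1)%N /\ size (reps d (p ^ k.+1)) = (2 * k.+2)%N.
elim: k => [|k [IH1 IH2]].
  split; rewrite ?expn0 //; have := rec 1%N; rewrite r1 gtnNdvd //; last lia.
  by rewrite muln1 expn1 addn0 => ->.
split=> //; have := rec (p ^ k.+1)%N; rewrite -expnS IH2.
have -> : (p ^ k.+1 %/ p = p ^ k)%N by rewrite expnS mulKn.
by rewrite [in (_ %| _)%N]expnS dvdn_mulr // IH1; lia.
Qed.

(** * Primes of the form x^2 + 5 y^2 *)

(** The polynomial [X^p - X] has at most [p] roots, and the [p] elements of the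
    prime field are already roots. *)
Lemma pchar_fixed_natr (p : nat) (F : fieldType) (w : F) :
  p \in [pchar F] -> w ^+ p = w -> exists c : nat, w = c%:R.
Proof.
move=> pF wp; have p_pr := pcharf_prime pF.
pose rs := [seq i%:R : F | i <- iota 0 p].
have [/mapP[c _ ->]|w_rs] := boolP (w \in rs); first by exists c.
have [/eqP | p_n0] := eqVneq ('X^p - 'X : {poly F}) 0.
  rewrite subr_eq0 => /eqP/(congr1 (fun f : {poly F} => f`_1)); rewrite coefXn coefX /=.
  rewrite ltn_eqF ?prime_gt1 // => /eqP.
  by rewrite eq_sym oner_eq0.
have /= := max_poly_roots p_n0 (rs := w :: rs).
have -> : size ('X^p - 'X : {poly F}) = p.+1.
  by rewrite size_polyDl size_polyXn // size_polyN size_polyX ltnS prime_gt1.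
rewrite size_map size_iota ltnn => H; suff: false by []; apply: H.
  rewrite /root !hornerE wp subrr eqxx /=; apply/allP => _ /mapP[i _ ->].
  by rewrite /root !hornerE -(pFrobenius_autE pF) pFrobenius_aut_nat subrr.
rewrite w_rs map_inj_in_uniq ?iota_uniq // => i j.
rewrite !mem_iota !add0n /= => lt_i lt_j.
wlog le_ij : i j lt_i lt_j / (i <= j)%N.
  by move=> H E; case/orP: (leq_total i j) => le; [exact: H|exact/esym/H].
move=> /esym/eqP; rewrite -subr_eq0 -natrB // -(dvdn_pcharf pF) => /dvdn_leq.
by case: (posnP (j - i)) => [|_ /(_ isT)]; lia.
Qed.

(** Since [p] is [1] or [9] modulo [20], [20] divides [p^2 - 1], and the field
    with [p^2] elements contains a primitive [20]th root of unity [z].  Then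
    [i = z^5] is a square root of [-1], and [t = z^4 + z^-4] satisfies
    [t^2 + t = 1], so that [2 t + 1] is a square root of [5].  The Frobenius map
    fixes [i] as [p] is [1] modulo [4], and fixes [t] as [p] is [1] or [-1]
    modulo [5]; hence the square root [i (2 t + 1)] of [-5] is in the prime
    field. *)
Lemma dvdn_sqr_add5 (p : nat) : prime p ->
  (p = 1 %[mod 20] \/ p = 9 %[mod 20])%N -> exists c : nat, (p %| c ^ 2 + 5)%N.
Proof.
move=> p_pr p_mod.
have [F pF cardF] := PrimePowerField p_pr (isT : 0 < 2)%N.
have d20 : (20 %| (p ^ 2).-1)%N.
  have [q [r [Ep Er]]] : exists q r, (p = 20 * q + r)%N /\ (r = 1 \/ r = 9)%N.
    by exists (p %/ 20)%N, (p %% 20)%N; split; [lia|case: p_mod; lia].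
  apply/dvdnP; exists (20 * q ^ 2 + 2 * q * r + (r == 9) * 4)%N.
  (* The last term is [(r^2 - 1) / 20]. *)
  by case: Er Ep => -> ->; nia.
have [z prim_z] : exists z : F, 20.-primitive_root z.
  pose n := (p ^ 2).-1.
  have n_gt0 : (0 < n)%N by have := prime_gt1 p_pr; rewrite /n; nia.
  have /hasP[g _ prim_g] : has n.-primitive_root (enum (predC1 (0 : F))).
    apply: has_prim_root => //; rewrite ?enum_uniq //.
      apply/allP => x; rewrite mem_enum inE => x0; rewrite unity_rootE.
      apply/eqP/(mulfI x0); rewrite -exprS mulr1 /n prednK ?expn_gt0 ?prime_gt0 //.
      by rewrite -cardF expf_card.
    by rewrite -cardE cardC1 cardF.
  by exists (g ^+ (n %/ 20)); apply: dvdn_prim_root.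
have zn (i j : nat) : (z ^+ i == z ^+ j) = (i == j %[mod 20]) by apply: eq_prim_root_expr.
pose s := z ^+ 4; pose t := s + s^-1; pose i := z ^+ 5.
have z_n0 : z != 0 by rewrite (prim_root_eq0 prim_z).
have i2 : i ^+ 2 = -1.
  have /eqP : i ^+ 2 * i ^+ 2 = 1 by rewrite -exprM -exprD; apply: prim_expr_order.
  rewrite -expr2 sqrf_eq1 => /orP[]/eqP // E.
  by have := zn (5 * 2)%N 0%N; rewrite expr0 exprM -/i E eqxx.
have s_n1 : s != 1 by have := zn 4 0; rewrite expr0 => ->.
have s5 : s ^+ 5 = 1 by rewrite -exprM; apply: prim_expr_order.
have s_n0 : s != 0 by rewrite expf_neq0.
have t2 : t ^+ 2 + t = 1.
  (* As [s^2 (t^2 + t - 1) = 1 + s + s^2 + s^3 + s^4], multiplying by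
     [s^2 (s - 1)] gives [s^5 - 1]. *)
  apply: (mulfI (_ : s - 1 != 0)); first by rewrite subr_eq0.
  apply: (mulfI (_ : s ^+ 2 != 0)); first by rewrite expf_neq0.
  transitivity ((s ^+ 5 - 1) + (s - 1) * s ^+ 2); last by rewrite s5; ring.
  by rewrite /t; field.
pose w := i * (2 * t + 1).
have w2 : w ^+ 2 = - 5.
  rewrite /w exprMn i2; transitivity (- (4 * (t ^+ 2 + t) + 1)); first by ring.
  by rewrite t2; ring.
have wp : w ^+ p = w.
  have E (x y : F) : (x + y) ^+ p = x ^+ p + y ^+ p.
    exact: (rmorphD (pFrobenius_aut pF) x y).
  have ip : i ^+ p = i.
    by apply/eqP; rewrite /i -exprM zn; lia.
  have sp : s ^+ p = s \/ s ^+ p = s^-1.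
    case: p_mod => pm; [left|right].
      by apply/eqP; rewrite /s -exprM zn; lia.
    apply: (mulIf s_n0); rewrite mulVf // /s -exprM -exprD; apply/eqP.
    by rewrite -[1](expr0 z) zn; lia.
  have tp : t ^+ p = t.
    by rewrite /t E exprVn; case: sp => -> //; rewrite invrK addrC.
  have two_p : 2 ^+ p = 2 :> F by exact: (pFrobenius_aut_nat pF 2).
  by rewrite /w exprMn ip E expr1n exprMn tp two_p.
have [c Ec] := pchar_fixed_natr pF wp.
exists c; rewrite (dvdn_pcharf pF) natrD natrX -Ec w2.
by rewrite addrC subrr.
Qed.

Lemma exists_sqrtn n : exists s, (s ^ 2 <= n < s.+1 ^ 2)%N.
Proof.
elim: n => [|n [s /andP[les lts]]]; first by exists 0%N.
have [E|ne] := eqVneq n.+1 (s.+1 ^ 2)%N.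
  by exists s.+1; rewrite E leqnn /= ltn_exp2r.
by exists s; rewrite (leq_trans les) //= ltn_neqAle ne lts.
Qed.

(** Thue's lemma, by the pigeonhole principle: with [s] the integer square root
    of [p] there are [(s + 1)^2 > p] pairs [(u, v)] with entries at most [s], so
    two of them have the same [u + c v] modulo [p]. *)
Lemma thue_small_solution (p c : nat) : prime p ->
  exists x y : int, [/\ (x, y) != (0, 0), x ^+ 2 < p%:Z, y ^+ 2 < p%:Z & (p %| x - c%:Z * y)%Z].
Proof.
move=> p_pr; have p_gt0 := prime_gt0 p_pr.
have [s /andP[les lts]] := exists_sqrtn p.
have lt_sp : (s ^ 2 < p)%N.
  rewrite ltn_neqAle les andbT; apply/eqP => E; have := p_pr.
  rewrite -E; case/primeP => _ /(_ s); rewrite dvdn_exp // => /(_ isT).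
  case/orP => /eqP Es; first by move: p_pr; rewrite -E Es.
  have : (s * s == s * 1)%N by rewrite mulnn muln1 -Es.
  rewrite eqn_mul2l => /orP[]/eqP s0; by move: p_pr; rewrite -E s0.
pose f (u : 'I_s.+1 * 'I_s.+1) : 'I_p := Ordinal (ltn_pmod (u.1 + c * u.2)%N p_gt0).
have /injectivePn[u [v ne E]] : ~~ injectiveb f.
  apply/negP => /injectiveP/leq_card; rewrite card_prod !card_ord leqNgt; lia.
exists (u.1%:Z - v.1%:Z), (v.2%:Z - u.2%:Z); split.
- apply: contraNneq ne => -[E1 E2]; case: u v E1 E2 {E} => u1 u2 [v1 v2] /= E1 E2.
  by apply/eqP; congr pair; apply: val_inj => /=; lia.
- by have := ltn_ord u.1; have := ltn_ord v.1; nia.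
- by have := ltn_ord u.2; have := ltn_ord v.2; nia.
move/(congr1 val): E => /= /eqP E.
suff -> : u.1%:Z - v.1%:Z - c%:Z * (v.2%:Z - u.2%:Z) = (u.1 + c * u.2)%N%:Z - (v.1 + c * v.2)%N%:Z.
  by rewrite -eqz_mod_dvd !modz_nat.
by rewrite !PoszD !PoszM; ring.
Qed.

Lemma int_division (e : nat) (z : int) : (0 < e)%N ->
  exists k r, z = e%:Z * k + r /\ 0 <= r < e%:Z.
Proof.
move=> e_gt0; exists (z %/ e)%Z, (z %% e)%Z; rewrite mulrC -divz_eq; split=> //.
by rewrite modz_ge0 ?ltz_pmod //; lia.
Qed.

Lemma sqr_mod5 (x : int) :
  (exists k, x = 5 * k) \/ exists K, x ^+ 2 = 5 * K + 1 \/ x ^+ 2 = 5 * K + 4.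
Proof.
have [k [r [-> rb]]] := int_division x (isT : 0 < 5)%N.
have E : (5%:Z * k + r) ^+ 2 = 5 * (5 * k ^+ 2 + 2 * k * r) + r ^+ 2 by ring.
have [r0|[r1|[r2|[r3|r4]]]] : r = 0 \/ (r = 1 \/ (r = 2 \/ (r = 3 \/ r = 4))) by lia.
- by left; exists k; rewrite r0 addr0.
- by right; exists (5 * k ^+ 2 + 2 * k * r); left; rewrite E r1.
- by right; exists (5 * k ^+ 2 + 2 * k * r); right; rewrite E r2.
- by right; exists (5 * k ^+ 2 + 2 * k * r + 1); right; rewrite E r3; ring.
by right; exists (5 * k ^+ 2 + 2 * k * r + 3); left; rewrite E r4; ring.
Qed.

Lemma even_sqr_add5 (x y n : int) : x ^+ 2 + 5 * y ^+ 2 = 4 * n ->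
  exists k l, x = 2 * k /\ y = 2 * l.
Proof.
have [k [r [-> rb]]] := int_division x (isT : 0 < 2)%N.
have [l [s [-> sb]]] := int_division y (isT : 0 < 2)%N.
have rE : r = 0 \/ r = 1 by lia.
have sE : s = 0 \/ s = 1 by lia.
have -> : (2%:Z * k + r) ^+ 2 + 5 * (2%:Z * l + s) ^+ 2 =
    4 * (k ^+ 2 + k * r + 5 * (l ^+ 2 + l * s)) + (r ^+ 2 + 5 * s ^+ 2) by ring.
move: (k ^+ 2 + _) => K E; exists k, l.
by case: rE sE {rb sb} E => -> [] -> E; rewrite ?addr0 //; exfalso; lia.
Qed.

(** For [m] equal to [2] or [3], [m p] is not a square modulo [5], as [p] is [1]
    or [-1] modulo [5].  For [m = 4] both coordinates are even, and for [m = 5]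
    the first one is a multiple of [5], so the factor [m] can be removed. *)
Lemma form5_reduce (x y p m q : int) : x ^+ 2 + 5 * y ^+ 2 = m * p -> 0 < m < 6 ->
  p = 5 * q + 1 \/ p = 5 * q + 4 -> exists a b, a ^+ 2 + 5 * b ^+ 2 = p.
Proof.
move=> E m_bd pE.
have [m1|[[m2|m3]|[m4|m5]]] : m = 1 \/ ((m = 2 \/ m = 3) \/ (m = 4 \/ m = 5)) by lia.
- by exists x, y; rewrite E m1 mul1r.
- exfalso; move: E; rewrite m2.
  have [[k ->]|[K]] := sqr_mod5 x.
    have -> : (5 * k) ^+ 2 = 5 * (5 * k ^+ 2) by ring.
    by move: (k ^+ 2) (y ^+ 2) pE => a b; clear; case=> ->; lia.
  by move: (x ^+ 2) (y ^+ 2) pE => a b; clear => -[] -> [] ->; lia.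
- exfalso; move: E; rewrite m3.
  have [[k ->]|[K]] := sqr_mod5 x.
    have -> : (5 * k) ^+ 2 = 5 * (5 * k ^+ 2) by ring.
    by move: (k ^+ 2) (y ^+ 2) pE => a b; clear; case=> ->; lia.
  by move: (x ^+ 2) (y ^+ 2) pE => a b; clear => -[] -> [] ->; lia.
- move: E; rewrite m4 => E; have [k [l [xE yE]]] := even_sqr_add5 E.
  exists k, l; apply: (@mulfI _ 4) => //; rewrite -E xE yE; ring.
move: E; rewrite m5 => E; have [[k xE]|[K xK]] := sqr_mod5 x.
  exists y, k; apply: (@mulfI _ 5) => //; rewrite -E xE; ring.
exfalso; move: E xK; move: (x ^+ 2) (y ^+ 2) => a b; clear => E [] ae; lia.
Qed.

(** Thue's lemma for a square root of [-5] gives a multiple [m p] of [p] below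
    [6 p] that is represented by [x^2 + 5 y^2]. *)
Lemma prime_form5 (p : nat) : prime p ->
  (p = 1 %[mod 20] \/ p = 9 %[mod 20])%N ->
  exists a b : int, a ^+ 2 + 5%:Z * b ^+ 2 = p%:Z.
Proof.
move=> p_pr p_mod; have [c pc] := dvdn_sqr_add5 p_pr p_mod.
have [x [y [ne x_lt y_lt pxy]]] := thue_small_solution c p_pr.
have : (p %| x ^+ 2 + 5%:Z * y ^+ 2)%Z.
  have -> : x ^+ 2 + 5%:Z * y ^+ 2 = (x - c%:Z * y) * (x + c%:Z * y) + y ^+ 2 * (c ^ 2 + 5)%N%:Z.
    by rewrite PoszD -!mulnn PoszM; ring.
  by apply: dvdzD; [exact: dvdz_mulr|exact: dvdz_mull].
case/dvdzP => m Em.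
have p_gt0 := prime_gt0 p_pr.
have m_gt0 : 0 < m.
  have : 0 < x ^+ 2 + 5%:Z * y ^+ 2.
    have [x0|x_n0] := eqVneq x 0; last by nia.
    have y_n0 : y != 0 by apply: contraNneq ne => ->; rewrite x0.
    by nia.
  by rewrite Em pmulr_lgt0 // ltz_nat.
have m_lt : m < 6 by rewrite -(ltr_pM2r (_ : 0 < p%:Z)) -?Em ?ltz_nat //; lia.
have [q pE] : exists q, p%:Z = 5 * q + 1 \/ p%:Z = 5 * q + 4.
  exists (p %/ 5)%N%:Z; clear -p_mod; case: p_mod => pm; [left|right]; lia.
by apply: (form5_reduce Em _ pE); rewrite m_gt0.
Qed.

(** * Congruences modulo powers of X and theta series *)

(** Congruence modulo [X^N]: power series are represented by polynomials known
    up to degree [N - 1]. *)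
Definition eq_modX (R : nzRingType) (N : nat) (f g : {poly R}) :=
  forall i, (i < N)%N -> f`_i = g`_i.

Lemma eq_modX_trans (R : nzRingType) N (g f h : {poly R}) :
  eq_modX N f g -> eq_modX N g h -> eq_modX N f h.
Proof. by move=> fg gh i lt_i; rewrite fg ?gh. Qed.

Lemma eq_modXM (R : nzRingType) N (f g h k : {poly R}) :
  eq_modX N f g -> eq_modX N h k -> eq_modX N (f * h) (g * k).
Proof.
move=> fg hk i lt_i; rewrite !coefM; apply: eq_bigr => j _.
by rewrite fg ?hk // (leq_ltn_trans _ lt_i) ?leq_subr // -ltnS.
Qed.

Lemma eq_modXMl (R : nzRingType) N (h f g : {poly R}) :
  eq_modX N f g -> eq_modX N (h * f) (h * g).
Proof. exact: eq_modXM. Qed.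

Lemma eq_modXMr (R : nzRingType) N (h f g : {poly R}) :
  eq_modX N f g -> eq_modX N (f * h) (g * h).
Proof. by move=> fg; apply: eq_modXM. Qed.

(** A polynomial with constant term [1] is invertible modulo [X^N]. *)
Lemma eq_modX_cancel (R : nzRingType) N (f g h : {poly R}) : f`_0 = 1 ->
  eq_modX N (f * g) (f * h) -> eq_modX N g h.
Proof.
move=> f0 fgh i; have [m] := ubnP i; elim: m i => // m IH i lt_im lt_iN.
have := fgh i lt_iN; rewrite !coefM !big_ord_recl /= f0 !mul1r subn0.
set a := \sum_(j < i) _; set b := \sum_(j < i) _.
have -> : a = b; last by move/addIr.
apply: eq_bigr => j _; congr (_ * _); apply: IH; rewrite /bump /=; have := ltn_ord j; lia.
Qed.

(** The truncation of the theta series [sum_(x in Z) (-1)^x q^(x^2)]. *)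
Definition theta (R : nzRingType) (M : nat) : {poly R} :=
  \sum_(x <- box M) (-1) ^+ `|x|%N *: 'X^(`|x| ^ 2).

Lemma thetaE (R : comNzRingType) M : 
  theta R M = 1 + \sum_(j < M) 2 * (-1) ^+ j.+1 * 'X ^+ (j.+1 ^ 2).
Proof.
rewrite /theta; elim: M => [|M IH]; first by rewrite big_seq1 big_ord0 addr0 !expr0 scale1r.
rewrite big_ord_recr /= !big_cons IH abszN -!mul_polyC rmorphXn rmorphN rmorph1 /=.
by move: ((-1) ^+ M.+1) ('X^_) (\sum_(i < M) _) => c u v; ring.
Qed.

Definition overpartition_poly (R : nzRingType) (c N : nat) : {poly R} :=
  \poly_(i < N) (size (overpartitions_below c i))%:R.

Lemma overpartition_poly_rec (R : nzRingType) (x : nat * bool) N : (0 < x.1)%N ->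
  eq_modX N (overpartition_poly R (code x).+1 N)
        (overpartition_poly R (code x) N + 'X^(x.1) * overpartition_poly R x.1.*2.+1 N).
Proof.
move=> x_gt0 i lt_i; rewrite coefD coefXnM !coef_poly lt_i.
rewrite size_overpartitions_below_rec // natrD; congr (_ + _).
by case: (leqP x.1 i) => // le; rewrite (leq_ltn_trans (leq_subr _ _) lt_i).
Qed.

(** Each pair of letters, plain [a] and overlined [a], contributes the factor
    [(1 + q^a) / (1 - q^a)]. *)
Lemma overpartition_poly_prod (R : comNzRingType) m N :
  eq_modX N (\prod_(i < m) (1 - 'X^(i.+1)) * overpartition_poly R m.*2.+2 N)
        (\prod_(i < m) (1 + 'X^(i.+1))).
Proof.
elim: m => [|m IH].
  move=> i lt_i; rewrite !big_ord0 mul1r coef_poly lt_i coef1.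
  by rewrite size_overpartitions_below2.
have e0 := @overpartition_poly_rec R (m.+1, false) N isT.
have e1 := @overpartition_poly_rec R (m.+1, true) N isT.
move: e0 e1; rewrite /code /= addn0 addn1 doubleS.
set C0 := overpartition_poly _ m.*2.+2 _; set C1 := overpartition_poly _ m.*2.+3 _.
set C2 := overpartition_poly _ m.*2.+4 _ => e0 e1.
rewrite !big_ord_recr /=.
apply: (@eq_modX_trans _ _ (\prod_(i < m) (1 - 'X^(i.+1)) * C0 * (1 + 'X^(m.+1))));
  last exact: eq_modXMr.
rewrite -!mulrA; apply: eq_modXMl; rewrite [C0 * _]mulrC.
apply: (@eq_modX_trans _ _ ((1 - 'X^(m.+1)) * ((1 + 'X^(m.+1)) * C1))).
  by apply: eq_modXMl => i lt_i; rewrite e1 // mulrDl mul1r.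
rewrite mulrCA; apply: eq_modXMl => i lt_i.
by rewrite mulrBl mul1r coefB e0 // coefD addrK.
Qed.

Definition overpartition_gf (R : nzRingType) (N : nat) : {poly R} :=
  \poly_(i < N) (num_overpartitions i)%:R.

(** The generating function of overpartitions is [(-q; q) / (q; q)], the inverse
    of the theta series by Gauss's identity. *)
Lemma overpartition_gf_theta (R : comNzRingType) N M : (N <= M.+1)%N ->
  eq_modX N (overpartition_gf R N * theta R M) 1.
Proof.
move=> le_N.
pose Q : {poly R} := \prod_(i < M) (1 - 'X^(i.+1)).
have Q0 : Q`_0 = 1.
  rewrite -horner_coef0 /Q horner_prod big1 // => i _.
  by rewrite !hornerE expr0n /= subr0.
apply: (eq_modX_cancel Q0); rewrite mulr1 mulrA.
have -> : overpartition_gf R N = overpartition_poly R M.*2.+2 N.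
  apply/polyP => i; rewrite !coef_poly; case: ifP => // lt_i.
  by rewrite size_overpartitions_all //; lia.
apply: (@eq_modX_trans _ _ (\prod_(i < M) (1 + 'X^(i.+1)) * theta R M)).
  exact/eq_modXMr/overpartition_poly_prod.
rewrite thetaE shanks big_ord_recl /= mul0n expr0 mulr1 /qneg1 big_ord0 !mul1r /qtail.
rewrite big_mkord => i lt_i; rewrite coefD coef_sum [X in _ + X]big1 ?addr0 // => s _.
rewrite coefMXn ifT //; apply: leq_trans lt_i _; apply: leq_trans le_N _.
by rewrite leq_pmull.
Qed.

(** The operator [U_e], which keeps the coefficients of exponent divisible by
    [e]. *)
Definition section (R : nzRingType) (e : nat) (f : {poly R}) : {poly R} :=
  \poly_(i < size f) f`_(e * i).

Lemma coef_section (R : nzRingType) e (f : {poly R}) i : (0 < e)%N ->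
  (section e f)`_i = f`_(e * i).
Proof.
move=> e_gt0; rewrite coef_poly; case: ltnP => // le_f.
by rewrite nth_default // (leq_trans le_f) // leq_pmull.
Qed.

Lemma sectionM (R : comNzRingType) e (f g : {poly R}) : (0 < e)%N ->
  section e ((f \Po 'X^e) * g) = f * section e g.
Proof.
move=> e_gt0; apply/polyP => n; rewrite coef_section //.
rewrite comp_polyE -[in RHS](coefK f) poly_def !mulr_suml !coef_sum.
apply: eq_bigr => i _; rewrite -!scalerAl !coefZ -exprM !coefXnM coef_section //.
by rewrite ltn_pmul2l // mulnBr.
Qed.

Lemma eq_signr_odd (R : pzRingType) m n : odd m = odd n -> (-1) ^+ m = (-1) ^+ n :> R.
Proof. by move=> E; rewrite -signr_odd E signr_odd. Qed.

Lemma theta_comp (R : nzRingType) M e :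
  theta R M \Po 'X^e = \sum_(x <- box M) (-1) ^+ `|x|%N *: 'X^(e * `|x| ^ 2).
Proof.
rewrite /theta raddf_sum /=; apply: eq_bigr => x _.
by rewrite comp_polyZ comp_Xn_poly -exprM.
Qed.

Lemma size_reps_box d n M : (0 < d)%N -> (n <= M)%N ->
  size (reps d n) =
  count (fun z => norm_form d z == n%:Z) [seq (x, y) | x <- box M, y <- box M].
Proof.
move=> d_gt0 le_n; rewrite -size_filter; apply/perm_size/uniq_perm.
- exact: uniq_reps.
- by rewrite filter_uniq ?uniq_box_pairs.
move=> z; rewrite mem_reps // mem_filter mem_box_pairs; case: eqP => //= E.
have /andP[h1 h2] := norm_form_bound d_gt0 E.
by rewrite !(leq_trans _ le_n).
Qed.

(** The sign of the pair [(x, y)] depends only on [n]: as [d] is odd, [x + y] has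
    the parity of [x^2 + d y^2]. *)
Lemma coef_thetaM (R : comNzRingType) d n M : odd d -> (n <= M)%N ->
  (theta R M * (theta R M \Po 'X^d))`_n = (-1) ^+ n * (size (reps d n))%:R.
Proof.
move=> d_odd le_n; have d_gt0 : (0 < d)%N by case: d d_odd.
rewrite (size_reps_box d_gt0 le_n) theta_comp /theta big_distrlr /= coef_sum.
under eq_bigr => x _ do rewrite coef_sum.
rewrite -sum1_count natr_sum mulr_sumr [RHS]big_mkcond [RHS]big_allpairs /=.
apply: eq_bigr => x _; apply: eq_bigr => y _.
rewrite -scalerAl -scalerAr scalerA -exprD coefZ -exprD coefXn mulr_natr.
have -> : (norm_form d (x, y) == n%:Z) = (n == `|x| ^ 2 + d * `|y| ^ 2)%N.
  by rewrite /norm_form /=; apply/eqP/eqP; lia.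
case: eqP => [->|_]; last by rewrite mulr0n.
rewrite mulr1 mulr1n; apply: eq_signr_odd.
by rewrite !oddD oddM !oddX d_odd.
Qed.

Lemma coef_theta_sqr (R : comNzRingType) n M : (n <= M)%N ->
  (theta R M ^+ 2)`_n = (-1) ^+ n * (size (reps 1 n))%:R.
Proof. by move=> le_n; rewrite -(coef_thetaM R (d := 1) isT le_n) expr1 comp_polyXr. Qed.

(** The case [p = 5 = 1^2 + 2^2] and [d = 1] of [size_reps_mul_prime]. *)
Lemma section_theta_sqr (R : comNzRingType) M :
  eq_modX M.+1 (section 5 (theta R (5 * M) ^+ 2))
           (2 * theta R M ^+ 2 - (theta R M \Po 'X^5) ^+ 2).
Proof.
move=> i lt_i; rewrite coef_section // coef_theta_sqr ?leq_mul2l //.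
rewrite coefB -[2]/(2%:R) -polyC_natr coefCM coef_theta_sqr // -rmorphXn /= coef_comp_poly_Xn //.
have := @size_reps_mul_prime 1 5 i 1 2 isT isT isT erefl.
move/(congr1 (fun m => m%:R : R)); rewrite natrD natrM => E.
have -> : (-1) ^+ (5 * i) = (-1) ^+ i :> R by apply: eq_signr_odd; rewrite oddM.
rewrite mulrCA -E mulrDr; case: ifP => i5; last by rewrite mulr0 addr0 subr0.
rewrite coef_theta_sqr; last by rewrite (leq_trans (leq_div _ _)).
have -> : (-1) ^+ (i %/ 5) = (-1) ^+ i :> R.
  by apply: eq_signr_odd; rewrite -[in RHS](divnK i5) oddM andbT.
by rewrite addrK.
Qed.

Definition supported (R : nzRingType) (P : pred nat) (f : {poly R}) :=
  forall i, ~~ P i -> f`_i = 0.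

Lemma supportedM (R : nzRingType) (P Q T : pred nat) (f g : {poly R}) :
  (forall i j, P i -> Q j -> T (i + j)%N) ->
  supported P f -> supported Q g -> supported T (f * g).
Proof.
move=> PQT Pf Qg n nT; rewrite coefM big1 // => j _.
have le_j : (j <= n)%N := ltn_ord j.
have [Pj|nPj] := boolP (P j); last by rewrite Pf ?mul0r.
rewrite Qg ?mulr0 //; apply: contra nT => Qj.
by rewrite -(subnKC le_j); apply: PQT.
Qed.

Lemma theta_split (R : nzRingType) M :
  theta R (5 * M) = (theta R M \Po 'X^25) +
    \sum_(x <- box (5 * M) | ~~ (5 %| x)%Z) (-1) ^+ `|x|%N *: 'X^(`|x| ^ 2).
Proof.
rewrite /theta (bigID (fun x : int => 5 %| x)%Z) /=; congr (_ + _).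
rewrite -/(theta R M) theta_comp -big_filter.
have P : perm_eq [seq x <- box (5 * M) | (5 %| x)%Z] [seq 5%:Z * x | x <- box M].
  apply: uniq_perm; first by rewrite filter_uniq ?uniq_box.
    by rewrite map_inj_uniq ?uniq_box //; apply: mulfI.
  move=> x; rewrite mem_filter mem_box; apply/andP/mapP => [[/dvdzP[y ->] le_x]|[y + ->]].
    by exists y; rewrite 1?mulrC // mem_box; lia.
  by rewrite mem_box => le_y; rewrite dvdz_mulr //; split=> //; lia.
rewrite (perm_big _ P) big_map; apply: eq_bigr => x _.
by rewrite abszM expnMn -signr_odd oddM /= signr_odd.
Qed.

(** Write [T = A + D], where [A] collects the multiples of [5] in the theta
    series.  The exponents of [D] are [1] or [4] modulo [5], and those of [A] are
    [0]; so neither [D^3] nor [A^2 D] has an exponent divisible by [5].  As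
    [T^3 = D^3 - 3 A^2 D + A (3 T^2 - 2 A^2)], only the last term survives, and
    its factor [A] is a series in [q^25]. *)
Lemma section_theta_cube (R : comNzRingType) M :
  section 5 (theta R (5 * M) ^+ 3) =
  (theta R M \Po 'X^5) *
  (3 * section 5 (theta R (5 * M) ^+ 2) - 2 * (theta R M \Po 'X^5) ^+ 2).
Proof.
set T := theta R (5 * M); set B := theta R M \Po 'X^5.
pose A := B \Po 'X^5; pose D := T - A.
have AE : A = theta R M \Po 'X^25 by rewrite /A /B -comp_polyA comp_Xn_poly -exprM.
have DE : D = \sum_(x <- box (5 * M) | ~~ (5 %| x)%Z) (-1) ^+ `|x|%N *: 'X^(`|x| ^ 2).
  by rewrite /D /T theta_split -AE addrC addKr.
pose res (s : seq nat) (i : nat) := (i %% 5)%N \in s.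
have resM s1 s2 s (f g : {poly R}) :
    all (fun a => all (fun b => ((a + b) %% 5)%N \in s) s2) s1 ->
    supported (res s1) f -> supported (res s2) g -> supported (res s) (f * g).
  move=> /allP h; apply: supportedM => i j hi hj.
  by rewrite /res -modnDm; exact: (allP (h _ hi)).
have suppD : supported (res [:: 1; 4]%N) D.
  move=> i ni; rewrite DE coef_sum big1 // => x nx.
  rewrite coefZ coefXn; case: eqP => [Ei|]; last by rewrite mulr0.
  case/negP: ni; rewrite Ei /res -modnXm; move: nx; rewrite dvdzE /= /dvdn.
  by have := ltn_pmod `|x| (isT : 0 < 5)%N; case: (_ %% _)%N => [|[|[|[|[]]]]].
have suppA : supported (res [:: 0]%N) A.
  move=> i ni; rewrite /A coef_comp_poly_Xn // ifF //; apply/negbTE.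
  by move: ni; rewrite /res inE.
have suppDDD : supported (res [:: 1; 2; 3; 4]%N) (D * D * D).
  apply: (resM [:: 2; 0; 3]%N [:: 1; 4]%N) => //.
  exact: (resM [:: 1; 4]%N [:: 1; 4]%N [:: 2; 0; 3]%N D D isT suppD suppD).
have suppAAD : supported (res [:: 1; 4]%N) (A * A * D).
  apply: (resM [:: 0]%N [:: 1; 4]%N) => //.
  exact: (resM [:: 0]%N [:: 0]%N [:: 0]%N A A isT suppA suppA).
have E : T ^+ 3 = D * D * D - 3 * (A * A * D) + A * (3 * T ^+ 2 - 2 * A ^+ 2).
  by rewrite /D; ring.
have E0 : section 5 (T ^+ 3) = section 5 (A * (3 * T ^+ 2 - 2 * A ^+ 2)).
  apply/polyP => i; rewrite !coef_section // E coefD coefB -[3]/(3%:R) -polyC_natr coefCM.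
  by rewrite suppDDD ?suppAAD ?mulr0 ?subr0 ?add0r // /res modnMr.
rewrite E0 sectionM //; congr (_ * _); apply/polyP => i.
rewrite !(coef_section,coefB) // -[3]/(3%:R) -[2]/(2%:R) -!polyC_natr !coefCM coef_section //.
by rewrite -rmorphXn /= coef_comp_poly_Xn // dvdn_mulr // mulKn.
Qed.

(** * Overpartition pairs modulo 5 *)

Lemma overpartition_gf_Frobenius (R : comNzRingType) p N : p \in [pchar R] ->
  overpartition_gf R N ^+ p = overpartition_gf R N \Po 'X^p.
Proof.
move=> pR; have pP : p \in [pchar {poly R}] by rewrite pchar_poly.
rewrite /overpartition_gf poly_def -(pFrobenius_autE pP) !rmorph_sum /=.
apply: eq_bigr => i _; rewrite comp_polyZ comp_Xn_poly pFrobenius_autE exprZn -!exprM mulnC.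
by congr (_ *: _); rewrite -(pFrobenius_autE pR) pFrobenius_aut_nat.
Qed.

Lemma coef_overpartition_gf_sqr (R : comNzRingType) N n : (n < N)%N ->
  (overpartition_gf R N ^+ 2)`_n = (num_opairs n)%:R.
Proof.
move=> lt_n; rewrite num_opairs_conv natr_sum expr2 coefM; apply: eq_bigr => i _.
have le_i : (i <= n)%N := ltn_ord i.
by rewrite !coef_poly !(leq_ltn_trans _ lt_n) ?leq_subr // natrM.
Qed.

(** Inserting [section_theta_sqr] turns the bracket of [section_theta_cube] into
    [6 t^2 - 5 t(q^5)^2] with [t] the theta series, hence into [t^2] in
    characteristic [5]. *)
Lemma section_theta_cube_pchar5 (R : comNzRingType) M : 5 \in [pchar R] ->
  eq_modX M.+1 (section 5 (theta R (5 * M) ^+ 3))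
           ((theta R M \Po 'X^5) * theta R M ^+ 2).
Proof.
move=> R5; rewrite section_theta_cube; apply: eq_modXMl.
have five0 : 5 = 0 :> {poly R} by apply: pcharf0; rewrite pchar_poly.
move=> i lt_i; have := section_theta_sqr R lt_i.
set S := section _ _; set T := theta _ M ^+ 2; set B := _ ^+ 2 => Si.
have -> : T`_i = (3 * (2 * T - B) - 2 * B)`_i.
  have -> : 3 * (2 * T - B) - 2 * B = T + 5 * (T - B) by move: T B {Si} => T B; ring.
  by rewrite five0 mul0r addr0.
by rewrite !coefB -[3]/(3%:R) -polyC_natr !coefCM Si !coefB.
Qed.

(** Let [P] be the generating function of overpartitions and [t] the theta
    series, so that [P t = 1].  Then [P^2 = P^5 t^3 = P(q^5) t^3] in
    characteristic [5], and [U_5] sends this to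
    [P U_5(t^3) = P t^2 t(q^5) = t t(q^5)]. *)
Lemma num_opairs_pchar5 (R : comNzRingType) n : 5 \in [pchar R] ->
  (num_opairs (5 * n))%:R = (-1) ^+ n * (size (reps 5 n))%:R :> R.
Proof.
move=> R5; pose N := (5 * n).+1; pose P := overpartition_gf R N.
have PT : eq_modX N (P * theta R (5 * n)) 1 by apply: overpartition_gf_theta.
have Pt : eq_modX n.+1 (P * theta R n) 1.
  have := @overpartition_gf_theta R n.+1 n (leqnn _).
  apply: eq_modX_trans; apply: eq_modXMr => i lt_i; rewrite !coef_poly lt_i ifT //.
  by apply: leq_trans lt_i _; rewrite ltnS leq_pmull.
rewrite -(@coef_overpartition_gf_sqr _ N) // -/P.
rewrite -(coef_thetaM R (d := 5) isT (leqnn n)).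
have sT := section_theta_cube_pchar5 (M := n) R5.
have P5 : P ^+ 5 = P \Po 'X^5 by apply: overpartition_gf_Frobenius.
move: (theta R (5 * n)) (theta R n) PT Pt sT => T t PT Pt sT.
have E1 : eq_modX N (P ^+ 2) (P ^+ 5 * T ^+ 3).
  have -> : P ^+ 5 * T ^+ 3 = P ^+ 2 * (P * T) ^+ 3 by move: P {PT Pt P5} => P; ring.
  rewrite -[X in eq_modX _ X](mulr1 (P ^+ 2)).
  have e1 : eq_modX N (1 * (1 * 1)) ((P * T) ^+ 3).
    by apply: eq_modXM; [|apply: eq_modXM] => i lt_i; rewrite PT.
  by rewrite !mulr1 in e1; apply: eq_modXMl.
rewrite E1 // P5 -(coef_section _ n (isT : 0 < 5)%N) sectionM //.
rewrite (eq_modXMl P sT (leqnn _)).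
have -> : P * ((t \Po 'X^5) * t ^+ 2) = (P * t) * (t * (t \Po 'X^5)).
  by move: (t \Po _) => u; move: P {PT Pt P5 E1} => P; ring.
by rewrite (eq_modXMr _ Pt (leqnn _)) mul1r.
Qed.

Local Close Scope ring_scope.

Theorem theorem5p4 (p : nat) (hp : prime p)
    (hmod : p = 1 %[mod 20] \/ p = 9 %[mod 20]) (k : nat) (hk : 0 < k) :
  num_opairs (5 * p ^ k) = 3 * (k + 1) %[mod 5].
Proof.
have [a [b Eab]] := prime_form5 hp hmod.
have p_gt1 := prime_gt1 hp.
have p_gt5 : 5 < p by clear -hmod p_gt1; case: hmod => h; lia.
have p_odd : odd p by clear -hmod; case: hmod => h; lia.
have r5 : size (reps 5 (p ^ k)) = 2 * k.+1.
  by apply: (@size_reps_pow 5 p k a b) => //; apply: leq_trans p_gt5.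
have F5 := pchar_Fp (isT : prime 5).
have := num_opairs_pchar5 (p ^ k) F5.
rewrite r5 -signr_odd oddX p_odd orbT expr1 mulN1r => /eqP.
rewrite -addr_eq0 -natrD -(dvdn_pcharf F5) => h.
(* The multiple 5 (k + 1) of 5 is the sum of 2 (k + 1) and 3 (k + 1). *)
apply/eqP; rewrite -(eqn_modDr (2 * k.+1)) (eqP h : _ = 0).
by clear; lia.
Qed.
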